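(* Let $K$ be a field, let $R=\bigoplus_{d\ge 0}R_d$ be a graded affine $K$-algebra with $R_0=K$ which is a domain, and let $I\ne R$ be a homogeneous ideal of $R$ of height at least $2$. Then $I$ is not Cohen-Macaulay as an $R$-module.
   Context: Affine means finitely generated as a $K$-algebra. Put $R_+=\bigoplus_{d\ge1}R_d$. For a finitely generated graded nonzero $R$-module $M$, a sequence of homogeneous elements $a_1,\dots,a_k\in R_+$ is $M$-regular if each $a_i$ is a nonzero divisor on $M/(a_1,\dots,a_{i-1})M$; $\operatorname{depth}(M)$ is the maximal length of an $M$-regular sequence in $R_+$, $\dim(M)$ is the Krull dimension of $R/\operatorname{Ann}_R(M)$, and $M$ is Cohen-Macaulay if $\operatorname{depth}(M)=\dim(M)$. *)

(* Defs.v *)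
From HB Require Import structures.
From mathcomp Require Import all_boot all_order all_algebra.
From mathcomp.multinomials Require Import mpoly.

Set Implicit Arguments.
Unset Strict Implicit.
Unset Printing Implicit Defensive.

Import GRing.Theory.
Local Open Scope ring_scope.

Definition affine_algebra (K : fieldType) (R : comAlgType K) : Prop :=
  exists (n : nat) (g : 'I_n -> R),
    forall x : R, exists p : {mpoly K[n]}, x = mmap (in_alg R) g p.

(* R is the internal direct sum of the K-subspaces Rd d, and
   Rd d * Rd e is contained in Rd (d + e). *)
Record is_grading (K : fieldType) (R : comAlgType K) (Rd : nat -> {pred R}) :
    Prop := IsGrading {
  grading_subspace : forall d, submod_closed (Rd d);
  grading_mul : forall d e, {in Rd d & Rd e, forall x y, x * y \in Rd (d + e)%N};
  grading_span : forall x : R, exists (n : nat) (c : 'I_n -> R),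
    (forall i, c i \in Rd i) /\ x = \sum_i c i;
  grading_direct : forall (n : nat) (c : 'I_n -> R),
    (forall i, c i \in Rd i) -> \sum_i c i = 0 -> forall i, c i = 0
}.

Definition degree0_is_base (K : fieldType) (R : comAlgType K)
    (Rd : nat -> {pred R}) : Prop :=
  forall x : R, x \in Rd 0%N <-> exists k : K, x = k%:A.

Definition homogeneous (R : comNzRingType) (Rd : nat -> {pred R}) (a : R) :
    Prop :=
  exists d, a \in Rd d.

(* Membership in R_+, the sum of the Rd d with d >= 1. *)
Definition in_irrelevant (R : comNzRingType) (Rd : nat -> {pred R}) (a : R) :
    Prop :=
  exists (n : nat) (c : 'I_n -> R),
    (forall i : 'I_n, c i \in Rd i.+1) /\ a = \sum_i c i.

(* An [idealr] never contains 1, so properness of I is part of its type (and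
   likewise for [prime_idealr]).  I is the sum of its intersections with the
   Rd d. *)
Definition homogeneous_ideal (R : comNzRingType) (Rd : nat -> {pred R})
    (I : idealr R) : Prop :=
  forall x : R, x \in I -> exists (n : nat) (c : 'I_n -> R),
    (forall i : 'I_n, (c i \in Rd i) && (c i \in I)) /\ x = \sum_i c i.

(* The chain C_0 < C_1 < ... < C_n has length n. *)
Definition prime_chain (A : comNzRingType) (n : nat)
    (C : 'I_n.+1 -> prime_idealr A) : Prop :=
  forall i j : 'I_n.+1, (i < j)%N ->
    {subset C i <= C j} /\ ~ {subset C j <= C i}.

Definition is_krull_dim (A : comNzRingType) (n : nat) : Prop :=
  (exists C : 'I_n.+1 -> prime_idealr A, prime_chain C) /\
  (forall (m : nat) (C : 'I_m.+1 -> prime_idealr A),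
     prime_chain C -> (m <= n)%N).

Definition prime_height_ge (A : comNzRingType) (n : nat) (P : prime_idealr A) :
    Prop :=
  exists (m : nat) (C : 'I_m.+1 -> prime_idealr A),
    [/\ prime_chain C, C ord_max =i P & (n <= m)%N].

(* The height of I is the infimum of the heights of the primes containing I. *)
Definition height_ge (A : comNzRingType) (n : nat) (I : idealr A) : Prop :=
  forall P : prime_idealr A, {subset I <= P} -> prime_height_ge n P.

Section Modules.
Variables (R : comNzRingType) (M : lmodType R).

(* x lies in the submodule (s_1, ..., s_k) M. *)
Definition in_mulM (s : seq R) (x : M) : Prop :=
  exists y : 'I_(size s) -> M, x = \sum_(j < size s) s`_j *: y j.

(* a is a nonzero divisor on M / (s_1, ..., s_k) M. *)
Definition nonzero_divisor_mod (s : seq R) (a : R) : Prop :=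
  forall x : M, in_mulM s (a *: x) -> in_mulM s x.

Definition regular_seq (Rd : nat -> {pred R}) (s : seq R) : Prop :=
  (forall a, a \in s -> homogeneous Rd a /\ in_irrelevant Rd a) /\
  (forall i, (i < size s)%N -> nonzero_divisor_mod (take i s) s`_i).

Definition is_depth (Rd : nat -> {pred R}) (n : nat) : Prop :=
  (exists2 s : seq R, regular_seq Rd s & size s = n) /\
  (forall s : seq R, regular_seq Rd s -> (size s <= n)%N).

Definition is_annihilator (J : idealr R) : Prop :=
  forall a : R, a \in J <-> (forall x : M, a *: x = 0).

(* The annihilator J is a proper ideal exactly when M is nonzero; the dimension
   of the zero module is left undefined. *)
Definition is_dim (n : nat) : Prop :=
  exists2 J : idealr R, is_annihilator J & is_krull_dim {ideal_quot J} n.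

Definition cohen_macaulay (Rd : nat -> {pred R}) : Prop :=
  exists2 n : nat, is_depth Rd n & is_dim n.

End Modules.

(* The ideal I as an R-module, i.e. as a submodule of the regular module. *)
Section IdealModule.
Variables (R : comNzRingType) (I : idealr R).

Definition ideal_pred : {pred R^o} := fun x => (x : R) \in I.

Fact ideal_pred_submod : submod_closed ideal_pred.
Proof.
split; first exact: (idealr0 I).
by move=> a u v uI vI; apply: (@rpredD _ I (a * u) v) => //; apply: idealMr.
Qed.

HB.instance Definition _ :=
  GRing.isSubmodClosed.Build R R^o ideal_pred ideal_pred_submod.

Record ideal_module : Type :=
  IdealModule { ideal_val : R^o; _ : ideal_val \in ideal_pred }.

HB.instance Definition _ := [isSub for ideal_val].
HB.instance Definition _ := [Choice of ideal_module by <:].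
HB.instance Definition _ := [SubChoice_isSubLmodule of ideal_module by <:].

End IdealModule.

(* Main.v *)
Require Import Defs.
From mathcomp Require Import all_boot all_order all_algebra.
From HB Require Import structures.
From mathcomp Require Import boolp classical_sets.

(** Suppose that I is Cohen-Macaulay.  As R is a domain and I is nonzero,
    Ann(I) = 0, so there is an I-regular sequence of homogeneous elements of
    positive degree whose length is n = dim R.  The idea is that a module M with
    a regular sequence of length n cannot see an ideal A with dim R/A <= n - 2
    (Ischebeck's theorem): Hom(R/A, M) = 0 and Ext^1(R/A, M) = 0, that is, every
    R-linear map A -> M is multiplication by an element of M.  Now the height of
    I is at least 2, so two more primes can be put below any chain of primes
    above I, whence dim R/I <= n - 2.  But the inclusion I -> I is not
    multiplication by an element of I, because R is a domain and 1 is not in I.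

    The argument below is Ischebeck's, without Ext and without any finiteness:
    a dimension bound is only used through chains of primes, and a graded
    Nakayama argument is replaced by a degree count.  It works with congruences
    modulo a submodule N of a fixed graded module V, where N runs through the
    submodules generated by the initial segments of the regular sequence, and
    with the following two statements, where V_0 = 0 in the second one.

    - [regular_prime_tower]: if s is V/N-regular and u is nonzero in V/N, then
      above (N : u) there is a chain of size s + 1 primes.
    - [graph_trivial]: if s is V/N-regular and A -> V/N is a nonzero linear map
      of degree 0, then above A there is a chain of max(1, size s) primes.

    Both go by induction on s = x :: s'.  One finds an ideal A' containing A,
    modulo which x is a nonzero divisor, and a nonzero element, or a nonzero
    map on A' + (x), over V/(N + xV), to which the induction hypothesis applies.
    The chain that it provides consists of primes that contain x, and it can be
    extended by a prime below its first member ([prime_tower_nzd]), because a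
    prime containing A' and x contains a prime containing A' but not x.

    If no such element or map exists, then the given one is divisible by x, the
    quotient is again of the same kind, and so the given one is divisible by all
    powers of x; it is then zero for reasons of degree ([graded_separated]).

    For a map f of degree 0, the ideal A' consists of the r such that r f is
    multiplication by some m in V/N ([multiplier]).  The condition V_0 = 0
    enters when s is empty, where the claim is that A is not R: a map of degree
    0 on R is multiplication by an element of degree 0.  The theorem is the
    second statement applied to the inclusion of I into itself, with N = 0. *)

Set Implicit Arguments.
Unset Strict Implicit.
Unset Printing Implicit Defensive.

Import GRing.Theory.
Local Open Scope ring_scope.
Local Open Scope quotient_scope.

(** * Submodules and prime ideals *)

Definition is_submodule (R : comNzRingType) (V : lmodType R) (N : V -> Prop) :=
  N 0 /\ forall a u v, N u -> N v -> N (a *: u + v).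

Definition is_ideal (R : comNzRingType) (A : R -> Prop) :=
  is_submodule (A : R^o -> Prop).

(** The submodule N + xV. *)
Definition add_mul (R : comNzRingType) (V : lmodType R) (N : V -> Prop) (x : R)
    (v : V) : Prop :=
  exists u, N (v - x *: u).

Section Submodules.
Variables (R : comNzRingType) (V : lmodType R) (N : V -> Prop).
Hypothesis N_sub : is_submodule N.

Lemma submodule0 : N 0. Proof. by case: N_sub. Qed.

Lemma submoduleZ a u : N u -> N (a *: u).
Proof. by case: N_sub => N0 Nl Nu; rewrite -[_ *: _]addr0; exact: Nl. Qed.

Lemma submoduleD u v : N u -> N v -> N (u + v).
Proof. by case: N_sub => N0 Nl Nu Nv; rewrite -[u]scale1r; exact: Nl. Qed.

Lemma submoduleN u : N u -> N (- u).
Proof. by move=> Nu; rewrite -scaleN1r; exact: submoduleZ. Qed.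

Lemma submodule_sum n (F : nat -> V) :
  (forall i, N (F i)) -> N (\sum_(i < n) F i).
Proof.
by move=> NF; apply: big_ind => //; [exact: submodule0 | exact: submoduleD].
Qed.

Lemma add_mul_submodule x : is_submodule (add_mul N x).
Proof.
split=> [|a u v [u' Nu] [v' Nv]].
  by exists 0; rewrite scaler0 subr0; exact: submodule0.
exists (a *: u' + v'); rewrite scalerDr scalerA mulrC -scalerA opprD addrACA.
by rewrite -scalerBr; exact: N_sub.2.
Qed.

Lemma sub_add_mul x v : N v -> add_mul N x v.
Proof. by move=> Nv; exists 0; rewrite scaler0 subr0. Qed.

Lemma mul_add_mul x u : add_mul N x (x *: u).
Proof. by exists u; rewrite subrr; exact: submodule0. Qed.

Lemma colon_ideal u : is_ideal (fun r => N (r *: u)).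
Proof.
split=> [|a r s Nr Ns]; first by rewrite scale0r; exact: submodule0.
by rewrite scalerDl -[a *: r]/(a * r) -scalerA; exact: N_sub.2.
Qed.

End Submodules.

Section Ideals.
Variable R : comNzRingType.
Implicit Types (A : R -> Prop) (P Q : prime_idealr R).

Lemma idealMl A a r : is_ideal A -> A r -> A (a * r).
Proof. by move=> hA; exact: (submoduleZ hA). Qed.

Lemma prime_of_pred A : is_ideal A -> ~ A 1 ->
  (forall u v, A (u * v) -> A u \/ A v) ->
  exists P, forall r, r \in P <-> A r.
Proof.
move=> A_ideal A1 A_prime.
pose S : R -> bool := fun r => `[< A r >].
have S_idealr : idealr_closed S.
  split.
  - exact/asboolP/(submodule0 A_ideal).
  - exact/asboolPn.
  - move=> a u v /asboolP Au /asboolP Av; apply/asboolP.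
    exact: (A_ideal.2 a u v).
have S_prime : prime_idealr_closed S.
  move=> u v /asboolP/A_prime [Au|Av]; apply/orP; first by left; exact/asboolP.
  by right; exact/asboolP.
pose mI := isIdealr.Build R S S_idealr.
pose mP := isPrimeIdealrClosed.Build R S S_prime.
pose P : prime_idealr R := HB.pack S mI mP.
by exists P => r; split=> /asboolP.
Qed.

(** Krull's lemma, by Zorn: an ideal that contains [A] and is maximal among
    those disjoint from the multiplicative set [S] is prime. *)
Lemma prime_avoiding A (S : R -> Prop) : is_ideal A -> S 1 ->
    (forall a b, S a -> S b -> S (a * b)) -> (forall a, A a -> ~ S a) ->
  exists P, (forall a, A a -> a \in P) /\ (forall a, a \in P -> ~ S a).
Proof.
move=> A_ideal S1 S_mul AS.
(* The union with A makes the empty chain harmless in Zorn's lemma. *)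
pose good (X : set R) :=
  is_ideal (fun r => A r \/ X r) /\ forall a, A a \/ X a -> ~ S a.
have [F F_good F_tot|X [[X_ideal XS] X_max]] := @Zorn_bigcup R good.
  split; last first.
    by move=> a [|[X /F_good [_ XS] Xa]]; [exact: AS | apply: XS; right].
  split=> [|a u v]; first by left; exact: submodule0 A_ideal.
  (* two elements of the union already lie in a common member of the chain *)
  have step (X : set R) : F X -> A u \/ X u -> A v \/ X v ->
      A (a * u + v) \/ (\bigcup_(X in F) X)%classic (a * u + v).
    move=> FX Xu Xv; have [[_ Xl] _] := F_good _ FX.
    by case: (Xl a u v Xu Xv) => [|Xauv]; [left | right; exists X].
  move=> [Au|[X FX Xu]] [Av|[Y FY Yv]].
  - by left; exact: (A_ideal.2 a u v).
  - by apply: (step Y) => //; [left | right].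
  - by apply: (step X) => //; [right | left].
  - case: (F_tot _ _ FX FY) => [XY|YX].
      by apply: (step Y) => //; right => //; exact: XY.
    by apply: (step X) => //; right => //; exact: YX.
pose B r := A r \/ X r.
(* By maximality, B + (u) meets S for every u outside B. *)
have B_meets u : ~ B u -> exists2 s, add_mul (B : R^o -> Prop) u s & S s.
  move=> Bu; apply: contrapT => noS.
  pose Y : set R := add_mul (B : R^o -> Prop) u.
  have AY r : A r \/ Y r -> Y r.
    by case=> // Ar; apply: sub_add_mul => //; left.
  have BY : is_ideal (fun r => A r \/ Y r).
    split=> [|a r s /AY Yr /AY Ys]; first by left; exact: submodule0 A_ideal.
    by right; apply: (add_mul_submodule X_ideal u).2.
  have XY : (X `<` Y)%classic.
    split=> [r Xr|YX]; first by apply: sub_add_mul => //; right.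
    apply: Bu; right; apply: YX.
    by have := mul_add_mul X_ideal u 1; rewrite /GRing.scale /= mulr1.
  apply: X_max XY _; split=> // a /AY Ya Sa.
  by apply: noS; exists a.
have B_prime u v : B (u * v) -> B u \/ B v.
  move=> Buv; apply: contrapT => /not_orP [/B_meets [s [r Br] Ss]].
  move=> /B_meets [t [q Bq] St]; apply: (XS (s * t)); last exact: S_mul.
  rewrite -/(B _).
  (* s and t are congruent to u r and v q modulo B. *)
  have -> : s * t = t * (s - u * r) + (u * r * (t - v * q) + (r * q) * (u * v)).
    rewrite !mulrBr [r * q * _]mulrACA [r * u]mulrC [q * v]mulrC.
    by rewrite subrK [t * (u * r)]mulrC subrK mulrC.
  by apply: (submoduleD X_ideal); [|apply: (submoduleD X_ideal)];
    apply: (idealMl _ X_ideal).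
have [P PB] := prime_of_pred X_ideal (fun B1 => XS 1 B1 S1) B_prime.
by exists P; split=> a; [move=> Aa; apply/PB; left | move/PB/XS].
Qed.

Lemma prime_over A : is_ideal A -> ~ A 1 ->
  exists P, forall a, A a -> a \in P.
Proof.
move=> A_ideal A1; have [|a b -> ->|a Aa a1|P [AP _]] :=
  @prime_avoiding A (fun r => r = 1) A_ideal; rewrite ?mulr1 //.
  by rewrite -a1 in A1.
by exists P.
Qed.

(** This replaces the fact that a nonzero divisor modulo [A] avoids the minimal
    primes over [A].  The multiplicative set to avoid consists of the x^k t with
    t outside [P]; it misses [A], since x^k t in [A] would imply t in [A]. *)
Lemma prime_below A P x : is_ideal A -> (forall a, A a -> a \in P) ->
    (forall r, A (x * r) -> A r) ->
  exists Q, [/\ forall a, A a -> a \in Q, {subset Q <= P} & x \notin Q].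
Proof.
move=> A_ideal AP x_nzd.
pose S a := exists k t, t \notin P /\ a = x ^+ k * t.
have x_nzdX k r : A (x ^+ k * r) -> A r.
  by elim: k => [|k IH]; rewrite ?mul1r // exprS -mulrA => /x_nzd.
have [|a b|a Aa|Q [AQ QS]] := @prime_avoiding A S A_ideal.
- by exists 0%N, 1; rewrite idealr1 mul1r.
- move=> [k [t [tP ->]]] [l [s [sP ->]]]; exists (k + l)%N, (t * s).
  by rewrite prime_idealrM negb_or tP sP exprD mulrACA.
- move=> [k [t [tP def_a]]]; move: tP; rewrite AP //.
  by apply: (x_nzdX k); rewrite -def_a.
exists Q; split=> // [a aQ|].
  by apply/negPn/negP => aP; apply: (QS a) => //; exists 0%N, a; rewrite mul1r.
by apply/negP => /QS; apply; exists 1%N, 1; rewrite idealr1 mulr1.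
Qed.

End Ideals.

(** * Chains of primes *)

Section Towers.
Variable R : comNzRingType.
Implicit Types (A B : R -> Prop) (P Q : prime_idealr R).

(** A strictly increasing chain of [n] primes containing [A], listed from the
    bottom; the element x witnesses that the inclusion of P in the next prime is
    strict.  For an ideal [A], this says that dim R/A >= n - 1. *)
Fixpoint prime_tower n A : Prop :=
  if n is n'.+1 then
    exists P x, [/\ forall a, A a -> a \in P, x \notin P &
                    prime_tower n' (fun a => a \in P \/ a = x)]
  else True.

Lemma prime_tower_sub n A B :
  (forall a, A a -> B a) -> prime_tower n B -> prime_tower n A.
Proof.
case: n => // n AB [P [x [BP xP tow]]]; exists P, x; split=> // a /AB.
exact: BP.
Qed.

Lemma prime_tower_leq m n A : (m <= n)%N -> prime_tower n A -> prime_tower m A.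
Proof.
elim: m n A => [|m IH] [|n] A //= le_mn [P [x [AP xP tow]]].
by exists P, x; split=> //; exact: IH tow.
Qed.

Lemma prime_tower1 A : is_ideal A -> ~ A 1 -> prime_tower 1 A.
Proof.
move=> A_ideal A1; have [P AP] := prime_over A_ideal A1.
by exists P, 1; split; rewrite // idealr1.
Qed.

(** This is how dimension drops: dim R/(A + (x)) < dim R/A when x is a nonzero
    divisor modulo [A]. *)
Lemma prime_tower_nzd n A B x : is_ideal A -> (forall r, A (x * r) -> A r) ->
    (forall a, A a -> B a) -> B x ->
  prime_tower n.+1 B -> prime_tower n.+2 A.
Proof.
move=> A_ideal x_nzd AB Bx [P [y [BP yP tow]]].
have [a /AB /BP //|Q [AQ QP xQ]] := prime_below (P := P) A_ideal _ x_nzd.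
exists Q, x; split=> //; exists P, y; split=> // a [/QP //|->]; exact: BP.
Qed.

(** This puts a chain of primes above an ideal on top of a chain that ends with
    its first member. *)
Lemma prime_chain_tower n m (C : 'I_m.+1 -> prime_idealr R) x :
    prime_chain C -> x \notin C ord_max ->
    prime_tower n (fun a => a \in C ord_max \/ a = x) ->
  exists D : 'I_(m + n).+1 -> prime_idealr R, prime_chain D.
Proof.
elim: n m C x => [|n IH] m C x C_chain xC; first by rewrite addn0; exists C.
move=> [P [y [CP yP tow]]]; rewrite addnS -addSn.
pose D (i : 'I_m.+2) := if unlift ord_max i is Some j then C j else P.
have D_max : D ord_max = P by rewrite /D unlift_none.
have D_lift j : D (lift ord_max j) = C j by rewrite /D liftK.
apply: (IH _ D y); rewrite ?D_max // => i j.
case: (unliftP ord_max i) => [i'|] ->; last first.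
  by rewrite ltnNge /= -ltnS ltn_ord.
case: (unliftP ord_max j) => [j'|] ->; rewrite ?D_max !D_lift.
  by rewrite !lift_max; exact: C_chain.
move=> _; have sub_max : {subset C i' <= C ord_max}.
  have [lt_im|] := ltnP i' m; first by have [] := C_chain i' ord_max lt_im.
  move=> le_mi; suff -> : i' = ord_max by [].
  by apply/val_inj/eqP; rewrite eqn_leq le_mi -ltnS ltn_ord.
split=> [a /sub_max aC|PC]; first by apply: CP; left.
by move: xC; rewrite (sub_max x) //; apply/PC/CP; right.
Qed.

End Towers.

(** * Graded modules *)

Section Graded.
Variables (R : comNzRingType) (Rd : nat -> {pred R}).

Definition positive_degree (x : R) := exists2 d, (0 < d)%N & x \in Rd d.

(** A grading is given by its projections [pi d] onto the homogeneous
    components.  Having the sum for all large m allows the sums of several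
    elements to be cut at the same place. *)
Record graded_module (V : lmodType R) (pi : nat -> V -> V) : Prop :=
    GradedModule {
  componentD : forall d, {morph pi d : u v / u + v};
  component_sum : forall v, exists n, forall m, (n <= m)%N ->
    v = \sum_(d < m) pi d v;
  component_orth : forall d e v, pi d (pi e v) = if d == e then pi e v else 0;
  componentZ : forall e a, a \in Rd e -> forall d v,
    pi d (a *: v) = if (e <= d)%N then a *: pi (d - e)%N v else 0
}.

Definition homogeneous_submodule (V : lmodType R) (pi : nat -> V -> V)
    (N : V -> Prop) :=
  forall d v, N v -> N (pi d v).

(** The projections of the twisted module V(-e). *)
Definition shift (V : lmodType R) (e : nat) (pi : nat -> V -> V) d v :=
  if (e <= d)%N then pi (d - e)%N v else 0.

Section Components.
Variables (V : lmodType R) (pi : nat -> V -> V).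
Hypothesis pi_graded : graded_module pi.

Lemma component0 d : pi d 0 = 0.
Proof.
by apply: (addrI (pi d 0)); rewrite -(componentD pi_graded) !addr0.
Qed.

Lemma componentN d v : pi d (- v) = - pi d v.
Proof.
by apply: (addrI (pi d v)); rewrite -(componentD pi_graded) !subrr component0.
Qed.

Lemma componentB d u v : pi d (u - v) = pi d u - pi d v.
Proof. by rewrite (componentD pi_graded) componentN. Qed.

Lemma shift_graded e : graded_module (shift e pi).
Proof.
split=> [d u v|v|d d' v|f a aRf d v]; rewrite /shift.
- by case: ifP; rewrite ?addr0 ?(componentD pi_graded).
- have [n sum_v] := component_sum pi_graded v; exists (e + n)%N => m le_m.
  rewrite -(subnKC (leq_trans (leq_addr n e) le_m)) big_split_ord /=.
  rewrite big1 ?add0r => [|i _]; last by rewrite leqNgt ltn_ord.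
  rewrite {1}(sum_v (m - e)%N) ?leq_subRL ?(leq_trans (leq_addr n e)) //.
  by apply: eq_bigr => i _; rewrite leq_addr addKn.
- have [le_ed|lt_de] := leqP e d; have [le_ed'|lt_de'] := leqP e d'.
  + by rewrite (component_orth pi_graded) -(eqn_add2r e) !subnK.
  + by rewrite component0 if_same.
  + by rewrite [d == d']ltn_eqF // (leq_trans lt_de).
  + by rewrite if_same.
- have [le_ed|lt_de] := leqP e d; last first.
    rewrite [(e <= d - f)%N]leqNgt (leq_ltn_trans (leq_subr f d) lt_de) /=.
    by rewrite scaler0 if_same.
  rewrite (componentZ pi_graded aRf) leq_subRL //.
  have [le_fd|lt_df] := leqP f d; last first.
    by rewrite leqNgt (leq_trans lt_df) ?leq_addl.
  by rewrite leq_subRL // addnC subnAC; case: ifP; rewrite ?scaler0.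
Qed.

Lemma add_mul_homogeneous N x : is_submodule N ->
    homogeneous_submodule pi N -> positive_degree x ->
  homogeneous_submodule pi (add_mul N x).
Proof.
move=> N_sub N_hom [e _ xRe] d v [u Nu].
have := N_hom d _ Nu; rewrite componentB (componentZ pi_graded xRe).
case: ifP => _; first by exists (pi (d - e)%N u).
by rewrite subr0; exact: sub_add_mul.
Qed.

(** The component of degree d of x^j u is zero as soon as j > d, so each
    component of v lies in [N]. *)
Lemma graded_separated N x v : is_submodule N ->
    homogeneous_submodule pi N -> positive_degree x ->
    (forall j, exists u, N (v - x ^+ j *: u)) ->
  N v.
Proof.
move=> N_sub N_hom [e e_gt0 xRe] v_div.
have low j : forall d u, (d < j)%N -> pi d (x ^+ j *: u) = 0.
  elim: j => // j IH d u lt_dj.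
  rewrite exprS -scalerA (componentZ pi_graded xRe); case: ifP => // le_ed.
  rewrite IH ?scaler0 // -(ltn_add2l e) subnKC // (leq_trans lt_dj) //.
  by rewrite -add1n leq_add2r.
have [n sum_v] := component_sum pi_graded v; rewrite (sum_v n) //.
apply: (@submodule_sum _ _ _ N_sub n (pi^~ v)) => d; have [u Nu] := v_div d.+1.
by have := N_hom d _ Nu; rewrite componentB low // subr0.
Qed.

End Components.

(** * Regular sequences and annihilators *)

Fixpoint regular_mod (V : lmodType R) (N : V -> Prop) (s : seq R) : Prop :=
  if s is x :: s' then
    (forall u, N (x *: u) -> N u) /\ regular_mod (add_mul N x) s'
  else True.

(** The bound depth(M) <= dim R/p for the associated primes p of M, in a form
    that does not require them to exist. Let U be the submodule killed by
    (N : u) modulo [N]. If U were contained in N + xV, then every element of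
    U would be divisible by x with a quotient in U, hence by all powers of x. So some v
    in U is nonzero modulo N + xV; it is killed by (N : u) and by x, and x is a
    nonzero divisor modulo (N : u). *)
Lemma regular_prime_tower (V : lmodType R) (pi : nat -> V -> V)
    (N : V -> Prop) s u :
    graded_module pi -> is_submodule N -> homogeneous_submodule pi N ->
    (forall x, x \in s -> positive_degree x) -> regular_mod N s -> ~ N u ->
  prime_tower (size s).+1 (fun r => N (r *: u)).
Proof.
move=> pi_graded; elim: s N u => [|x s IH] N u N_sub N_hom s_pos.
  by move=> _ Nu; apply: prime_tower1; [exact: colon_ideal | rewrite scale1r].
move=> [x_nzd s_reg] Nu.
have x_pos : positive_degree x by apply: s_pos; rewrite mem_head.
pose U v := forall r, N (r *: u) -> N (r *: v).
have [v Uv xv] : exists2 v, U v & ~ add_mul N x v.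
  apply: contrapT => U_div.
  have {}U_div v : U v -> exists2 w, U w & N (v - x *: w).
    move=> Uv; apply: contrapT => v_div; apply: U_div; exists v => // -[w Nw].
    apply: v_div; exists w => // r /Uv Nrv; apply: x_nzd; rewrite scalerA mulrC.
    rewrite -scalerA -[_ *: _](subrK (r *: v)); apply: submoduleD => //.
    by rewrite -opprB -scalerBr; apply: submoduleN => //; exact: submoduleZ.
  apply: Nu; apply: (graded_separated pi_graded N_sub N_hom x_pos) => j.
  suff [w _ Nw] : exists2 w, U w & N (u - x ^+ j *: w) by exists w.
  elim: j => [|j [w Uw Nw]].
    by exists u; rewrite // scale1r subrr; exact: submodule0.
  have [w' Uw' Nw'] := U_div w Uw; exists w' => //.
  rewrite exprSr -scalerA -[u](subrK (x ^+ j *: w)) -addrA -scalerBr.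
  by apply: submoduleD => //; exact: submoduleZ.
apply: (@prime_tower_nzd _ _ _ (fun r => add_mul N x (r *: v)) x).
- exact: colon_ideal.
- by move=> r; rewrite -scalerA; exact: x_nzd.
- by move=> r /Uv; exact: sub_add_mul.
- exact: mul_add_mul.
apply: IH => //; first exact: add_mul_submodule.
  exact: (add_mul_homogeneous pi_graded).
by move=> y ys; apply: s_pos; rewrite inE ys orbT.
Qed.

(** * Linear maps of degree zero from an ideal *)

Section Graphs.
Variable c : nat -> R -> R.
Hypothesis c_graded : graded_module (V := R^o) c.
Hypothesis c_Rd : forall d r, c d r \in Rd d.

(** Only the component of degree d of r contributes in degree d + e. *)
Lemma component_scale_hom (V : lmodType R) (pi : nat -> V -> V) d e r v :
  graded_module pi -> pi (d + e)%N (r *: pi e v) = c d r *: pi e v.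
Proof.
move=> pi_graded; have [n sum_r] := component_sum c_graded r.
pose m := maxn n d.+1.
have lt_dm : (d < m)%N by rewrite leq_maxr.
have pi_sum k (F : 'I_k -> V) l :
    pi l (\sum_(i < k) F i) = \sum_(i < k) pi l (F i).
  by apply: (big_morph _ (componentD pi_graded l)); exact: component0.
rewrite {1}(sum_r m) ?leq_maxl // scaler_suml pi_sum.
rewrite (bigD1 (Ordinal lt_dm)) //= big1 ?addr0 => [|i].
  by rewrite (componentZ pi_graded (c_Rd d r)) leq_addr addKn
    (component_orth pi_graded) eqxx.
rewrite -val_eqE /= => ne_id; rewrite (componentZ pi_graded (c_Rd i r)).
case: ifP => // le_i; rewrite (component_orth pi_graded).
by rewrite -(eqn_add2l i) subnKC // eqn_add2r eq_sym (negPf ne_id) scaler0.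
Qed.

(** A linear map from an ideal of R to V/N, encoded by the submodule of R x V of
    all (r, v) such that v represents the image of r.  Maps into V/N are never
    lifted to V, so that no choice of representatives is needed. *)
Definition is_graph (V : lmodType R) (N : V -> Prop) (G : R -> V -> Prop) :=
  [/\ G 0 0, forall a r s v w, G r v -> G s w -> G (a * r + s) (a *: v + w) &
      forall v, G 0 v <-> N v].

Definition graph_dom (V : lmodType R) (G : R -> V -> Prop) r := exists v, G r v.

Definition graph_hom (V : lmodType R) (pi : nat -> V -> V)
    (G : R -> V -> Prop) :=
  forall d r v, G r v -> G (c d r) (pi d v).

Section GraphTheory.
Variables (V : lmodType R) (N : V -> Prop) (G : R -> V -> Prop).
Hypotheses (N_sub : is_submodule N) (G_graph : is_graph N G).

Lemma graph_dom_ideal : is_ideal (graph_dom G).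
Proof.
case: G_graph => G0 Gl _; split; first by exists 0.
by move=> a r s [v Grv] [w Gsw]; exists (a *: v + w); exact: Gl.
Qed.

Lemma graphB r s v w : G r v -> G s w -> G (r - s) (v - w).
Proof.
case: G_graph => G0 Gl _ Grv Gsw.
have := Gl (-1) s r w v Gsw Grv.
by rewrite mulN1r scaleN1r addrC [- w + v]addrC.
Qed.

Lemma graphZ a r v : G r v -> G (a * r) (a *: v).
Proof.
case: G_graph => G0 Gl _ Grv.
by have := Gl a r 0 v 0 Grv G0; rewrite !addr0.
Qed.

Lemma graph_eq r v w : G r v -> G r w -> N (v - w).
Proof.
case: (G_graph) => _ _ G0N Grv Grw; apply/G0N.
by have := graphB Grv Grw; rewrite subrr.
Qed.

Lemma graph_cong r v w : G r w -> N (v - w) -> G r v.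
Proof.
case: (G_graph) => _ Gl G0N Grw /G0N Gvw.
by have := Gl 1 0 r _ _ Gvw Grw; rewrite mulr0 add0r scale1r subrK.
Qed.

(** For the map f with graph [G], this is the graph of the map that sends r to
    the m such that r f is multiplication by m, when that m is unique modulo
    [N]. It extends f, and its domain is the annihilator of the class of f in
    Ext^1(R/A, V/N), where A is the domain of f. *)
Definition multiplier r m := forall a v, G a v -> N (r *: v - a *: m).

Lemma multiplier_lin a r s m n :
  multiplier r m -> multiplier s n -> multiplier (a * r + s) (a *: m + n).
Proof.
move=> rm sn b v Gbv.
rewrite scalerDl scalerDr scalerA [b * a]mulrC -!scalerA.
rewrite opprD addrACA -scalerBr.
by apply: N_sub.2; [exact: rm | exact: sn].
Qed.

Lemma graph_multiplier r v : G r v -> multiplier r v.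
Proof.
move=> Grv a w Gaw; have Gar := graphZ a Grv; rewrite mulrC in Gar.
exact: graph_eq (graphZ r Gaw) Gar.
Qed.

(** Compare components of degree d + e in r f(a) = a m, for a of degree e. *)
Lemma multiplier_hom (pi : nat -> V -> V) : graded_module pi ->
  homogeneous_submodule pi N -> graph_hom pi G -> graph_hom pi multiplier.
Proof.
move=> pi_graded N_hom G_hom d r m rm a v Gav.
have [n1 sum_v] := component_sum pi_graded v.
have [n2 sum_a] := component_sum c_graded a.
pose n := maxn n1 n2.
rewrite (sum_v n) ?leq_maxl // {1}(sum_a n) ?leq_maxr //.
rewrite scaler_sumr scaler_suml -sumrB.
apply: (@submodule_sum _ _ _ N_sub n
  (fun e => c d r *: pi e v - c e a *: pi d m)) => e.
have := N_hom (d + e)%N _ (rm _ _ (G_hom e _ _ Gav)).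
rewrite (componentB pi_graded) component_scale_hom //.
by rewrite (componentZ pi_graded (c_Rd e a)) leq_addl addnK.
Qed.

(** For a map f with values in xV + N, the map f / x. *)
Lemma divided_graph x : (forall u, N (x *: u) -> N u) ->
  is_graph N (fun r u => G r (x *: u)).
Proof.
case: (G_graph) => G0 Gl G0N x_nzd; split=> [|a r s v w Gv Gw|u].
- by rewrite scaler0.
- by rewrite scalerDr scalerA [x * a]mulrC -scalerA; exact: Gl.
- by split=> [/G0N /x_nzd //|Nu]; apply/G0N; exact: submoduleZ.
Qed.

Lemma divided_graph_hom (pi : nat -> V -> V) e x : graded_module pi ->
    x \in Rd e -> graph_hom pi G ->
  graph_hom (shift e pi) (fun r u => G r (x *: u)).
Proof.
move=> pi_graded xRe G_hom d r u /(G_hom d).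
by rewrite (componentZ pi_graded xRe) /shift; case: ifP; rewrite ?scaler0.
Qed.

(** For a map g, defined on an ideal B, the map from B + (x) to V/(N + xV) that
    is g on B and sends x to zero. *)
Definition reduced_graph x r m := exists q u, G (r - x * q) (m - x *: u).

Lemma reduced_graph_dom x :
  graph_dom (reduced_graph x) x.
Proof.
case: (G_graph) => G0 _ _; exists 0, 1, 0.
by rewrite mulr1 subrr scaler0 subrr.
Qed.

Lemma sub_reduced_graph x r m : G r m -> reduced_graph x r m.
Proof. by move=> Grm; exists 0, 0; rewrite mulr0 scaler0 !subr0. Qed.

(** The reduced map is well defined because x r in B implies r in B, and then
    g(x r) = x g(r) is zero modulo xV. *)
Lemma reduced_graphP x : (forall r, graph_dom G (x * r) -> graph_dom G r) ->
  is_graph (add_mul N x) (reduced_graph x).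
Proof.
case: (G_graph) => G0 Gl G0N x_nzd; split=> [|a r s v w|m].
- exact: sub_reduced_graph.
- move=> [q [u Gv]] [q' [u' Gw]]; exists (a * q + q'), (a *: u + u').
  have := Gl a _ _ _ _ Gv Gw.
  rewrite [x * (a * q + _)]mulrDr [x *: (_ + u')]scalerDr [x * (a * q)]mulrCA
    [x *: (a *: u)]scalerA [x * a]mulrC -scalerA.
  by rewrite !opprD addrACA -mulrBr [a *: v + w + _]addrACA -scalerBr.
- split=> [[q [u Gxq]]|[u Nu]]; last first.
    by exists 0, u; rewrite mulr0 subr0; exact/G0N.
  have [w Gqw] : graph_dom G q.
    apply: x_nzd; exists (- (m - x *: u)).
    by have := graphB G0 Gxq; rewrite !sub0r opprK.
  exists (u - w); apply/G0N.
  have := Gl x _ _ _ _ Gqw Gxq.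
  by rewrite sub0r subrr scalerBr opprB addrCA.
Qed.

Lemma reduced_graph_hom (pi : nat -> V -> V) x : graded_module pi ->
    positive_degree x -> graph_hom pi G -> graph_hom pi (reduced_graph x).
Proof.
move=> pi_graded [e _ xRe] G_hom d r m [q [u /(G_hom d)]].
rewrite (componentB c_graded) (componentB pi_graded).
rewrite (componentZ c_graded xRe) (componentZ pi_graded xRe).
case: ifP => _; first by exists (c (d - e)%N q), (pi (d - e)%N u).
by rewrite !subr0; exact: sub_reduced_graph.
Qed.

End GraphTheory.

(** The vanishing of Ext^1(R/A, V/N) in degree zero, when V_0 = 0. Write A for
    the domain of the map f with graph [G]. If the sequence is empty, A = R and
    f is multiplication by f(1), which has degree 0 and so is zero. Otherwise
    let x be its first element. Then x is a nonzero divisor on the class of f: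
    if x r f is multiplication by m, then A m is zero modulo N + xV, so m itself
    is zero modulo N + xV by [regular_prime_tower] and the absence of long
    chains above A, say m = x m', and r f is
    multiplication by m'. Hence the reduction of [multiplier] modulo x is a
    well-defined map on a larger ideal, and the induction hypothesis makes it
    zero: f takes its values in N + xV. The same holds for f / x, which is of
    degree zero into the twisted module, and so on; hence f is divisible by all
    powers of x. *)
Lemma graph_trivial (V : lmodType R) (s : seq R) (pi : nat -> V -> V)
    (N : V -> Prop) (G : R -> V -> Prop) :
    c 0%N 1 = 1 ->
    graded_module pi -> (forall v, pi 0%N v = 0) ->
    is_submodule N -> homogeneous_submodule pi N ->
    (forall x, x \in s -> positive_degree x) -> regular_mod N s ->
    is_graph N G -> graph_hom pi G ->
    ~ prime_tower (maxn 1 (size s)) (graph_dom G) ->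
  forall r v, G r v -> N v.
Proof.
move=> c1; elim: s pi N G => [|x s IH] pi N G pi_graded pi0 N_sub N_hom s_pos.
  move=> _ G_graph G_hom no_tower r v Grv.
  have [w Gw] : graph_dom G 1.
    apply: contrapT => G1; apply: no_tower; apply: prime_tower1 G1.
    exact: graph_dom_ideal G_graph.
  have := G_hom 0%N _ _ Gw; rewrite c1 pi0 => G10.
  have := graphZ G_graph r G10; rewrite mulr1 scaler0 => Gr0.
  by have := graph_eq G_graph Grv Gr0; rewrite subr0.
move=> [x_nzd s_reg] G_graph G_hom no_tower.
have x_pos : positive_degree x by apply: s_pos; rewrite mem_head.
have s'_pos y : y \in s -> positive_degree y.
  by move=> ys; apply: s_pos; rewrite inE ys orbT.
have max_size : maxn 1 (size (x :: s)) = (size s).+1 by exact/maxn_idPr.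
rewrite {}max_size in no_tower.
have Nx_sub := add_mul_submodule N_sub x.
have Nx_hom := add_mul_homogeneous pi_graded N_sub N_hom x_pos.
have no_tower_sub n (A : R -> Prop) : ((size s).+1 <= n)%N ->
    (forall r, graph_dom G r -> A r) -> ~ prime_tower n A.
  move=> le_n GA tow.
  by apply/no_tower/(prime_tower_leq le_n)/(prime_tower_sub GA).
(* Reduction modulo x; the grading varies with the power of x divided out. *)
have div pi' G' : graded_module pi' -> (forall v, pi' 0%N v = 0) ->
    homogeneous_submodule pi' N -> is_graph N G' -> graph_hom pi' G' ->
    (forall r, graph_dom G r -> graph_dom G' r) ->
  forall r v, G' r v -> add_mul N x v.
  move=> pi'_graded pi'0 N_hom' G'_graph G'_hom GG' r v G'rv.
  pose M := multiplier N G'.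
  have G'_M a w : G' a w -> M a w by exact: graph_multiplier.
  have G_M a : graph_dom G a -> graph_dom M a.
    by move=> /GG' [w G'aw]; exists w; exact: G'_M.
  have M_graph : is_graph N M.
    split; [|exact: multiplier_lin|].
      by move=> a w _; rewrite scale0r scaler0 subrr; exact: submodule0.
    move=> m; split=> [M0m|Nm a w _]; last first.
      by rewrite scale0r sub0r; apply: submoduleN => //; exact: submoduleZ.
    (* m is unique because no nonzero element is killed by the domain of G'. *)
    apply: contrapT => Nm.
    have tow : prime_tower (size s).+2 (fun a => N (a *: m)).
      exact: (regular_prime_tower pi_graded N_sub N_hom s_pos _ Nm).
    apply: no_tower_sub tow => // a /GG' [w /M0m].
    by rewrite scale0r sub0r => /(submoduleN N_sub); rewrite opprK.
  have M_nzd a : graph_dom M (x * a) -> graph_dom M a.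
    move=> [m Mm].
    have [[m' Nm]|Nm] := pselect (add_mul N x m).
      exists m' => b w G'bw; apply: x_nzd.
      have := submoduleD N_sub (Mm _ _ G'bw) (submoduleZ N_sub b Nm).
      rewrite !scalerBr addrA subrK -!scalerA.
      by rewrite [b *: (x *: m')]scalerA mulrC -scalerA.
    have tow := regular_prime_tower pi_graded Nx_sub Nx_hom s'_pos s_reg Nm.
    case: (@no_tower_sub _ _ _ _ tow) => // b /GG' [w G'bw]; exists (a *: w).
    rewrite -opprB scalerA; apply: submoduleN => //; exact: Mm.
  apply: contrapT => Nv; apply: Nv.
  apply: (IH pi' (add_mul N x) (reduced_graph M x) _ _ _ _ _ _ _ _ _ r) => //.
  - exact: add_mul_homogeneous.
  - exact: reduced_graphP.
  - by apply: reduced_graph_hom => //; exact: multiplier_hom.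
  (* The reduction is zero, or there is a chain of at least one prime above its
     domain, below which there is room for one more prime. *)
  - have -> : maxn 1 (size s) = (size s).-1.+1.
      by case: (size s) => // n; exact/maxn_idPr.
    move=> tow0.
    have le_size : ((size s).+1 <= (size s).-1.+2)%N by case: (size s).
    apply: (no_tower_sub _ _ le_size G_M).
    apply: (prime_tower_nzd (graph_dom_ideal M_graph) M_nzd _ _ tow0).
      by move=> a [m Mam]; exists m; exact: sub_reduced_graph.
    exact: reduced_graph_dom M_graph _.
  - by apply: sub_reduced_graph; exact: G'_M.
have [e e_gt0 xRe] := x_pos.
have iter j : forall pi' G', graded_module pi' -> (forall v, pi' 0%N v = 0) ->
    homogeneous_submodule pi' N -> is_graph N G' -> graph_hom pi' G' ->
    (forall r, graph_dom G r -> graph_dom G' r) ->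
  forall r v, G' r v -> exists u, N (v - x ^+ j *: u).
  elim: j => [|j IHj] pi' G' pi'_gr pi'0 N_hom' G'_graph G'_hom GG' r v G'rv.
    by exists v; rewrite scale1r subrr; exact: submodule0.
  have div' a w : G' a w -> add_mul N x w by exact: (div pi' G').
  have G'_div a w u : G' a w -> N (w - x *: u) -> G' a (x *: u).
    move=> G'aw Nw; apply: (graph_cong G'_graph G'aw).
    by rewrite -opprB; exact: submoduleN.
  have [u Nu] := div' _ _ G'rv.
  have [|||||a|w Nw] := IHj (shift e pi') (fun a w => G' a (x *: w))
    _ _ _ _ _ _ r u (G'_div _ _ _ G'rv Nu).
  - exact: shift_graded.
  - by move=> w; rewrite /shift leqNgt e_gt0.
  - move=> d w; rewrite /shift; case: ifP => _; first exact: N_hom'.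
    by move=> _; exact: submodule0.
  - exact: divided_graph.
  - exact: divided_graph_hom.
  - move=> /GG' [w G'aw]; have [t Nt] := div' _ _ G'aw.
    by exists t; exact: G'_div Nt.
  exists w; rewrite exprS -scalerA -[v](subrK (x *: u)) -addrA -scalerBr.
  by apply: submoduleD => //; exact: submoduleZ.
move=> r v Grv; apply: (graded_separated pi_graded N_sub N_hom x_pos) => j.
by apply: (iter j pi G) Grv.
Qed.

End Graphs.
End Graded.

(** * Regular sequences as successive quotients *)

Lemma in_mulM_nil (R : comNzRingType) (V : lmodType R) :
  @in_mulM R V [::] = (fun v => v = 0).
Proof.
apply/funext => v; apply/propext; split=> [[y ->]|->].
  by rewrite big_ord0.
by exists (fun=> 0); rewrite big_ord0.
Qed.

Lemma in_mulM_rcons (R : comNzRingType) (V : lmodType R) (s : seq R) (x : R) :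
  @in_mulM R V (rcons s x) = add_mul (@in_mulM R V s) x.
Proof.
apply/funext => v; apply/propext; rewrite /in_mulM /add_mul size_rcons.
split=> [[y ->]|[u [y def_v]]].
  exists (y ord_max), (fun i => y (widen_ord (leqnSn _) i)).
  rewrite big_ord_recr /= nth_rcons ltnn eqxx addrK.
  by apply: eq_bigr => i _; rewrite nth_rcons ltn_ord.
exists (fun i => if unlift ord_max i is Some j then y j else u).
rewrite big_ord_recr /= unlift_none nth_rcons ltnn eqxx.
rewrite -[v](subrK (x *: u)) def_v; congr (_ + _); apply: eq_bigr => i _.
rewrite nth_rcons ltn_ord; congr (_ *: _).
have -> : widen_ord (leqnSn (size s)) i = lift ord_max i.
  by apply: val_inj; rewrite /= /bump leqNgt ltn_ord.
by rewrite liftK.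
Qed.

Lemma regular_seq_mod (R : comNzRingType) (V : lmodType R)
    (Rd : nat -> {pred R}) (s : seq R) :
  regular_seq V Rd s -> regular_mod (fun v : V => v = 0) s.
Proof.
case=> _ s_reg; rewrite -in_mulM_nil.
suff reg t u : s = t ++ u -> regular_mod (@in_mulM R V t) u.
  exact: (reg [::]).
elim: u t => //= x u IH t def_s; split; last first.
  by rewrite -in_mulM_rcons; apply: IH; rewrite cat_rcons.
have lt_ts : (size t < size s)%N.
  by rewrite def_s size_cat /= addnS ltnS leq_addr.
have := s_reg _ lt_ts.
by rewrite def_s take_size_cat // nth_cat ltnn subnn.
Qed.

(** * Primes of a quotient ring *)

Lemma prime_quotient (R : comNzRingType) (J : idealr R) (P : prime_idealr R) :
    {subset J <= P} ->
  exists Q : prime_idealr {ideal_quot J},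
    forall r, (\pi_({ideal_quot J}) r \in Q) = (r \in P).
Proof.
move=> JP; pose A (q : {ideal_quot J}) := repr q \in P.
have A_pi r : A (\pi_({ideal_quot J}) r) = (r \in P).
  have : repr (\pi_({ideal_quot J}) r) - r \in P.
    by apply: JP; rewrite Quotient.idealrBE reprK.
  by move=> Pr; rewrite /A -[X in X \in P](subrK r) rpredDl.
have [|/=|u v|Q QA] := @prime_of_pred _ (fun q => A q).
- split=> [|a u v].
    by rewrite -[0](rmorph0 \pi_({ideal_quot J})) A_pi rpred0.
  rewrite -[a *: u + v]/(a * u + v) -[a]reprK -[u]reprK -[v]reprK.
  rewrite -rmorphM -rmorphD !A_pi => uP vP.
  by apply: rpredD => //; exact: idealMr.
- by rewrite -(rmorph1 \pi_({ideal_quot J})) A_pi idealr1.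
- rewrite -[u]reprK -[v]reprK -rmorphM !A_pi prime_idealrM.
  by move=> /orP.
- exists Q => r.
  by apply/idP/idP; [move/QA | move=> rP; apply/QA]; rewrite A_pi.
Qed.

(** * The homogeneous components of the ring and of the ideal *)

Section RingGrading.
Variables (K : fieldType) (R : comAlgType K) (Rd : nat -> {pred R}).
Hypothesis R_graded : is_grading Rd.

Let Rd0 d : 0 \in Rd d. Proof. by case: (grading_subspace R_graded d). Qed.

Let RdD d : {in Rd d &, forall u v, u + v \in Rd d}.
Proof.
case: (grading_subspace R_graded d) => _ Rdl u v uR vR.
by rewrite -[u]scale1r; exact: Rdl.
Qed.

Let RdB d : {in Rd d &, forall u v, u - v \in Rd d}.
Proof.
case: (grading_subspace R_graded d) => _ Rdl u v uR vR.
by rewrite addrC -scaleN1r; exact: Rdl.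
Qed.

(** Padding with zeros lets decompositions of different lengths be compared. *)
Definition decomposition (r : R) (f : nat -> R) :=
  (forall d, f d \in Rd d) /\
  exists n, forall m, (n <= m)%N -> r = \sum_(d < m) f d.

Lemma decomposition_uniq r f g :
  decomposition r f -> decomposition r g -> f =1 g.
Proof.
move=> [fR [n1 sum_f]] [gR [n2 sum_g]] d; apply/eqP; rewrite -subr_eq0.
pose m := maxn (maxn n1 n2) d.+1.
have le1 : (n1 <= m)%N by rewrite !leq_max leqnn.
have le2 : (n2 <= m)%N by rewrite !leq_max leqnn orbT.
have lt_dm : (d < m)%N by rewrite leq_maxr.
apply/eqP; apply: (grading_direct R_graded (c := fun i : 'I_m => f i - g i) _ _
  (Ordinal lt_dm)) => [i|]; first exact: RdB.
by rewrite sumrB -(sum_f m) // -(sum_g m) // subrr.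
Qed.

Lemma ord_decomposition n (c : 'I_n -> R) : (forall i, c i \in Rd i) ->
  decomposition (\sum_i c i) (fun d => oapp c 0 (insub d)).
Proof.
move=> cR; split=> [d|]; first by case: insubP => //= i _ <-.
exists n => m le_nm; rewrite -(subnKC le_nm) big_split_ord /=.
rewrite [X in _ + X]big1 ?addr0 => [|i _].
  by apply: eq_bigr => i _; rewrite valK.
by rewrite insubF // ltnNge leq_addr.
Qed.

Lemma decomposition_exists r : exists f, decomposition r f.
Proof.
have [n [c [cR ->]]] := grading_span R_graded r.
by exists (fun d => oapp c 0 (insub d)); exact: ord_decomposition.
Qed.

Definition component d (r : R) : R := projT1 (cid (decomposition_exists r)) d.

Lemma componentP r : decomposition r (component^~ r).
Proof. exact: projT2 (cid (decomposition_exists r)). Qed.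

Lemma component_eq r f : decomposition r f -> forall d, component d r = f d.
Proof. exact: decomposition_uniq (componentP r). Qed.

Lemma component_in d r : component d r \in Rd d.
Proof. by case: (componentP r). Qed.

Lemma component_homogeneous e a d :
  a \in Rd e -> component d a = if d == e then a else 0.
Proof.
move=> aR; apply: (component_eq (f := fun d => if d == e then a else 0)).
split=> [i|]; first by case: eqP => [->|].
exists e.+1 => m lt_em; rewrite (bigD1 (Ordinal lt_em)) //= eqxx big1 ?addr0 //.
by move=> i; rewrite -val_eqE /= => /negPf ->.
Qed.

Lemma component_graded : graded_module Rd (component : nat -> R^o -> R^o).
Proof.
split=> [d u v|v|d e v|e a aR d v].
- apply: (component_eq (f := fun d => component d u + component d v)).
  have [uR [n1 sum_u]] := componentP u; have [vR [n2 sum_v]] := componentP v.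
  split=> [i|]; first exact: RdD.
  exists (maxn n1 n2) => m; rewrite geq_max => /andP [le1 le2].
  by rewrite big_split /= -(sum_u m) // -(sum_v m).
- by case: (componentP v).
- by apply: component_homogeneous; exact: component_in.
- apply: (component_eq
    (f := fun d => if (e <= d)%N then a * component (d - e)%N v else 0)).
  have [vR [n sum_v]] := componentP v; split=> [i|].
    case: ifP => // le_ei.
    by have := grading_mul R_graded aR (vR (i - e)%N); rewrite subnKC.
  exists (e + n)%N => m le_m; have le_em := leq_trans (leq_addr n e) le_m.
  rewrite -(subnKC le_em) big_split_ord /= big1 ?add0r => [|i _]; last first.
    by rewrite leqNgt ltn_ord.
  rewrite {1}(sum_v (m - e)%N) ?leq_subRL // /GRing.scale /= mulr_sumr.
  by apply: eq_bigr => i _; rewrite leq_addr addKn.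
Qed.

Lemma homogeneous_ideal_component (I : idealr R) d r :
  homogeneous_ideal Rd I -> r \in I -> component d r \in I.
Proof.
move=> I_hom /I_hom [n [c [cRI ->]]].
have cR i : c i \in Rd i by case/andP: (cRI i).
rewrite (component_eq (ord_decomposition cR)).
by case: insubP => [i _ _|_] /=; [case/andP: (cRI i) | exact: idealr0].
Qed.

(** An element of degree 0 in the irrelevant ideal is zero, and zero also has
    degree 1. *)
Lemma irrelevant_positive_degree x :
  homogeneous Rd x -> in_irrelevant Rd x -> positive_degree Rd x.
Proof.
case=> -[|d] xR [n [c [cR def_x]]]; last by exists d.+1.
suff -> : x = 0 by exists 1%N.
have := component_homogeneous 0 xR; rewrite eqxx => <-.
rewrite def_x (big_morph _ (componentD component_graded 0)
  (component0 component_graded 0)).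
by rewrite big1 // => i _; rewrite (component_homogeneous _ (cR i)).
Qed.

Section IdealGrading.
Variable I : idealr R.
Hypothesis I_hom : homogeneous_ideal Rd I.

Definition ideal_component d (v : ideal_module I) : ideal_module I :=
  IdealModule (homogeneous_ideal_component d I_hom (valP v) :
    (component d (val v) : R^o) \in ideal_pred I).

Lemma ideal_component_graded : graded_module Rd ideal_component.
Proof.
split=> [d u v|v|d e v|e a aR d v].
- by apply: val_inj; exact: (componentD component_graded).
- have [n sum_v] := component_sum component_graded (val v).
  exists n => m le_nm; apply: val_inj.
  by rewrite (raddf_sum val) (sum_v m).
- apply: val_inj; rewrite /= (component_orth component_graded).
  by case: ifP.
- apply: val_inj; rewrite /= (componentZ component_graded aR).
  by case: ifP.
Qed.

(** A nonzero element of degree 0 is a nonzero constant, and a proper ideal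
    contains none. *)
Lemma ideal_component0 : degree0_is_base Rd ->
  forall v, ideal_component 0 v = 0.
Proof.
move=> R_conn v; apply: val_inj => /=.
have [k def_v] := (R_conn _).1 (component_in 0 (val v)).
have : component 0 (val v) \in I by exact: (valP (ideal_component 0 v)).
rewrite def_v; case: (eqVneq k 0) => [->|k_neq0]; first by rewrite scale0r.
move=> /(idealMr k^-1%:A); rewrite -scalerAl mul1r scalerA mulVf // scale1r.
by rewrite idealr1.
Qed.

End IdealGrading.
End RingGrading.

(** * Ideals of height at least two *)

Theorem lemma4 (K : fieldType) (R : comAlgType K) (Rd : nat -> {pred R})
  (I : idealr R)
  (R_affine : affine_algebra R)
  (R_domain : GRing.integral_domain_axiom R)
  (R_graded : is_grading Rd)
  (R_connected : degree0_is_base Rd)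
  (I_homogeneous : homogeneous_ideal Rd I)
  (I_height : height_ge 2 I) :
  ~ cohen_macaulay (ideal_module I) Rd.
Proof.
case=> n [[s s_reg size_s] _] [J J_ann [_ dim_le_n]].
(* I is nonzero, since its annihilator is a proper ideal. *)
have [a [aI a_neq0]] : exists a, a \in I /\ a != 0.
  apply: contrapT => I0; have := idealr1 J.
  suff -> : 1 \in J by [].
  apply/J_ann => v; rewrite scale1r; apply: val_inj; apply: contrapT => /eqP v0.
  by apply: I0; exists (val v); split; [exact: (valP v) | exact: v0].
have J0 r : r \in J -> r = 0.
  move=> /J_ann /(_ (IdealModule (aI : (a : R^o) \in ideal_pred I))).
  move=> /(congr1 val) /= ra0.
  by case/orP: (R_domain r a ra0) => /eqP // a0; rewrite a0 eqxx in a_neq0.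
(* J = 0, so dim R <= n. *)
have no_chain m (C : 'I_m.+1 -> prime_idealr R) : prime_chain C -> (m <= n)%N.
  move=> C_chain.
  have Q_ex i : exists Q : prime_idealr {ideal_quot J},
      forall r, (\pi_({ideal_quot J}) r \in Q) = (r \in C i).
    by apply: prime_quotient => r /J0 ->; exact: idealr0.
  have [Q QC] := choice Q_ex; apply: (dim_le_n m Q) => i j lt_ij.
  have [sub_ij nsub_ji] := C_chain i j lt_ij.
  split=> [q|sub_ji]; first by rewrite -[q]reprK !QC; exact: sub_ij.
  by apply: nsub_ji => r; rewrite -!QC; exact: sub_ji.
(* The inclusion of I into itself. *)
pose G (r : R) (v : ideal_module I) := r = val v.
have G_graph : is_graph (fun v => v = 0) G.
  split=> // [b r t v w -> -> //|v].
  by split=> [v0|->//]; apply: val_inj.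
have tow : prime_tower (maxn 1 n) (fun r => r \in I).
  apply: contrapT => no_tower; move/eqP: a_neq0; apply.
  pose v : ideal_module I := IdealModule (aI : (a : R^o) \in ideal_pred I).
  suff : v = 0 by move=> /(congr1 val).
  have pi_graded := ideal_component_graded R_graded I_homogeneous.
  apply: (graph_trivial (component_graded R_graded) (component_in R_graded)
    (s := s) (N := fun v => v = 0) (G := G) _ pi_graded _ _ _ _ _ _ _ _
    (erefl : G a v)).
  - rewrite (component_homogeneous R_graded (e := 0)) //.
    by apply/R_connected; exists 1; rewrite scale1r.
  - exact: ideal_component0.
  - by split=> // b u w -> ->; rewrite scaler0 addr0.
  - by move=> d w ->; exact: component0 pi_graded d.
  - by move=> x /(s_reg.1 x) []; exact: irrelevant_positive_degree.
  - exact: regular_seq_mod s_reg.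
  - exact: G_graph.
  - by move=> d r w ->.
  - rewrite size_s => tow; apply/no_tower/(prime_tower_sub _ tow) => r rI.
    by exists (IdealModule (rI : (r : R^o) \in ideal_pred I)).
have [k def_k] : exists k, maxn 1 n = k.+1.
  by exists (maxn 1 n).-1; rewrite prednK // leq_maxl.
rewrite def_k in tow; case: tow => P [x [IP xP tow]].
(* P has height at least 2: the chain C of m + 1 >= 3 primes ends with P, and k
   larger primes follow. *)
have [m [C [C_chain C_max le2m]]] := I_height P IP.
have [||D D_chain] := @prime_chain_tower _ k _ C x C_chain.
- by rewrite C_max.
- by apply: prime_tower_sub tow => r; rewrite C_max.
have := no_chain _ _ D_chain; apply/negP; rewrite -ltnNge.
have le_nk : (n <= k.+1)%N by rewrite -def_k leq_maxr.
by apply: (leq_ltn_trans le_nk); rewrite -[k.+2]add2n leq_add2r.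
Qed.
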